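(* For every integer $n\geq 0$ and every even integer $t\geq 2$, let $a_t^*(n)$ be the total number of hooks of length $t$ among all self-conjugate partitions of $n$ (i.e. $a_t^*(n)=\sum_{\lambda\in\mathcal{SC}(n)} n_t(\lambda)$). Then $$a_t^*(n)=t\sum_{j\geq 1}|\mathcal{SC}(n-2jt)|\qquad\text{and}\qquad a_t^*(n)\equiv 0 \pmod t.$$ For every integer $n\ge 0$ and every odd integer $t\geq 3$, let $a_t^*(n)=\sum_{\lambda\in\mathrm{BG}_t(n)} n_t(\lambda)$ be the total number of hooks of length $t$ among all partitions of $n$ lying in $\mathrm{BG}_t$. Then $$a_t^*(n)=(t-1)\sum_{j\geq 1}|\mathrm{BG}_t(n-2jt)|\qquad\text{and}\qquad a_t^*(n)\equiv 0 \pmod{t-1}.$$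
   Context: A partition $\lambda=(\lambda_1\ge\dots\ge\lambda_\ell>0)$ of $n$ has weight $|\lambda|=\sum\lambda_i=n$. Its Durfee square has size $d=\max\{s:\lambda_s\ge s\}$. For a box $v$ of the Ferrers diagram, the hook length $h_v(\lambda)$ is $1$ plus the number of boxes strictly to the right of $v$ in its row plus the number strictly below $v$ in its column; $n_t(\lambda)$ is the number of boxes of $\lambda$ with hook length exactly $t$. The conjugate $\lambda'$ has parts $\lambda'_i=\#\{j:\lambda_j\ge i\}$; $\lambda$ is self-conjugate if $\lambda=\lambda'$, and $\mathcal{SC}$ denotes the set of self-conjugate partitions. For odd $t$, $\mathrm{BG}_t$ is the set of self-conjugate partitions $\lambda$ such that $t$ does not divide the diagonal hook length $h_{(i,i)}(\lambda)$ for every $1\le i\le d$. For a set $A$ of partitions, $A(m)$ denotes the subset of partitions of $m$ (empty if $m<0$). *)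

(* Defs.v *)
From HB Require Import structures.
From mathcomp Require Import all_boot.

Set Implicit Arguments.
Unset Strict Implicit.
Unset Printing Implicit Defensive.

(* A partition is the sequence of its parts; the part lambda_s (s >= 1) is
   nth 0 la s.-1. *)
Definition is_part (la : seq nat) : bool := sorted geq la && (0 \notin la).

Definition is_part_of (n : nat) (la : seq nat) : bool :=
  is_part la && (sumn la == n).

Record intpart (n : nat) : Type := IntPart {
  parts :> seq nat;
  partsP : is_part_of n parts
}.

HB.instance Definition _ n := [isSub for @parts n].
HB.instance Definition _ n := [Countable of intpart n by <:].

Lemma size_le_sumn (la : seq nat) : 0 \notin la -> size la <= sumn la.
Proof.
elim: la => //= x la IH; rewrite inE negb_or eq_sym -lt0n => /andP[x0 /IH le_la].
by rewrite -add1n leq_add.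
Qed.

Lemma part_le_sumn (la : seq nat) x : x \in la -> x <= sumn la.
Proof.
elim: la => //= y la IH; rewrite inE => /orP[/eqP->|/IH le_x].
  exact: leq_addr.
exact: leq_trans le_x (leq_addl _ _).
Qed.

Definition intpart_code n (la : intpart n) : n.-bseq 'I_n.+1 :=
  insub_bseq n [seq inord x | x <- parts la].

Definition intpart_decode n (b : n.-bseq 'I_n.+1) : option (intpart n) :=
  insub [seq val x | x <- b].

Lemma intpart_codeK n : pcancel (@intpart_code n) (@intpart_decode n).
Proof.
case=> la laP; rewrite /intpart_code /intpart_decode /=.
have /andP[/andP[_ la0] /eqP sum_la] := laP.
have sz : size [seq inord x : 'I_n.+1 | x <- la] <= n.
  by rewrite size_map; apply: leq_trans (size_le_sumn la0) _; rewrite sum_la.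
rewrite /insub_bseq insubdK // -map_comp.
have -> : map (val \o (fun x => inord x : 'I_n.+1)) la = la.
  rewrite -[RHS]map_id; apply/eq_in_map => x xla /=.
  by rewrite inordK // ltnS; apply: leq_trans (part_le_sumn xla) _; rewrite sum_la.
by rewrite insubT.
Qed.

HB.instance Definition _ n := isFinite.Build (intpart n)
  (pcan_enumP (@intpart_codeK n)).

(* The parts lambda'_i = #{j : lambda_j >= i} for 1 <= i <= lambda_1. *)
Definition conj_part (la : seq nat) : seq nat :=
  [seq count (leq i) la | i <- iota 1 (head 0 la)].

Definition self_conj (la : seq nat) : bool := conj_part la == la.

(* Boxes are pairs (row, column), both numbered from 0, with rows going down. *)
Definition boxes (la : seq nat) : seq (nat * nat) :=
  [seq (i, j) | i <- iota 0 (size la), j <- iota 0 (nth 0 la i)].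

Definition hook (la : seq nat) (v : nat * nat) : nat :=
  1 + count (fun w => (w.1 == v.1) && (v.2 < w.2)) (boxes la)
    + count (fun w => (w.2 == v.2) && (v.1 < w.1)) (boxes la).

Definition nhooks (t : nat) (la : seq nat) : nat :=
  count (fun v => hook la v == t) (boxes la).

(* This is 0 for the empty partition. *)
Definition durfee (la : seq nat) : nat :=
  \max_(1 <= s < (size la).+1 | s <= nth 0 la s.-1) s.

Definition is_BG (t : nat) (la : seq nat) : bool :=
  self_conj la && [forall i : 'I_(durfee la), ~~ (t %| hook la (val i, val i))].

Definition SC (n : nat) : {set intpart n} := [set la : intpart n | self_conj la].

Definition BG (t n : nat) : {set intpart n} := [set la : intpart n | is_BG t la].

(* Main.v *)
Require Import Defs.
From mathcomp Require Import all_boot.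
From mathcomp Require Import zify.

(* A self-conjugate partition is determined by the set D of those k for which
   2k + 1 is a diagonal hook length.  Its row ends S = {lambda_i - i - 1} satisfy
   k \in S <-> -1-k \notin S, and D is the nonnegative part of S.  The hooks of
   length t correspond to the k in S with t-1-k in S, so their number is
     #{k < t : k, t-1-k in D} + 2 #{k : k notin D, k+t in D}.
   Deleting such a pair {k, t-1-k}, or moving k+t to k, lowers the weight by 2t,
   and each of these moves is the symmetric difference of D with a fixed pair.
   Hence the number of hooks over weight n + 2t equals the number of reverse
   moves over weight n, and for every D the reverse moves outnumber the direct
   ones by c = #{k < t : t does not divide 2k+1}.  This gives the recursion
     a(n + 2t) = a(n) + c |BG_t(n)|,
   where c = t for t even and c = t - 1 for t odd.  For t even BG_t is all of SC,
   so both cases are instances of the same identity. *)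

Set Implicit Arguments.
Unset Strict Implicit.
Unset Printing Implicit Defensive.

(** * Moves on sets of diagonal hooks *)

(** Membership is tested on natural numbers, so that shifted indices such as [k + t] and [t - 1 - k]
    need no bound proof; it is false from [N] on. *)
Definition has_nat N (D : {set 'I_N}) (k : nat) : bool := k \in [seq val x | x in D].

(* The element k of D stands for the diagonal hook length 2k + 1. *)
Definition weight N (D : {set 'I_N}) : nat := \sum_(x in D) (2 * x + 1).

Definition avoids t N (D : {set 'I_N}) : bool :=
  [forall x in D, ~~ (t %| 2 * val x + 1)].

(** Symmetric difference with [{a}]: an involution on all sets, so moves can be reindexed without
    tracking their domains. *)
Definition toggle N (a : 'I_N) (D : {set 'I_N}) : {set 'I_N} :=
  [set x | (x \in D) (+) (x == a)].

Lemma has_natE N (D : {set 'I_N}) (x : 'I_N) : has_nat D x = (x \in D).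
Proof.
by apply/imageP/idP => [[y yD /val_inj->]|xD] //; exists x.
Qed.

Lemma has_nat_ltn N (D : {set 'I_N}) k : has_nat D k -> k < N.
Proof. by case/imageP=> x _ ->; apply: ltn_ord. Qed.

Lemma avoidsP t N (D : {set 'I_N}) :
  reflect (forall k, has_nat D k -> ~~ (t %| 2 * k + 1)) (avoids t D).
Proof.
apply: (iffP forall_inP) => [gD k /imageP[x xD ->]|gD x xD]; first exact: gD.
by apply: gD; rewrite has_natE.
Qed.

Lemma toggleK N (a : 'I_N) : involutive (toggle a).
Proof. by move=> D; apply/setP=> x; rewrite !inE; case: (x \in D); case: eqP. Qed.

Lemma weightE N (D : {set 'I_N}) : weight D = \sum_(x < N) has_nat D x * (2 * x + 1).
Proof.
rewrite /weight big_mkcond; apply: eq_bigr => x _; rewrite has_natE.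
by case: (x \in D); rewrite ?mul1n.
Qed.

(** A correction on each side covers insertion and deletion at once and avoids truncated
    subtraction. *)
Lemma weight_toggle N (a : 'I_N) (D : {set 'I_N}) :
  weight (toggle a D) + (a \in D) * (2 * a + 1)
    = weight D + (a \notin D) * (2 * a + 1).
Proof.
rewrite !weightE (bigD1 a) //= [in RHS](bigD1 a) //= !has_natE inE eqxx addbT.
rewrite (eq_bigr (fun x : 'I_N => has_nat D x * (2 * x + 1))); first by case: (a \in D) => /=; lia.
by move=> x /negPf xa; rewrite !has_natE inE xa addbF.
Qed.

Lemma avoids_toggle t N (a : 'I_N) (D : {set 'I_N}) :
  ~~ (t %| 2 * val a + 1) -> avoids t (toggle a D) = avoids t D.
Proof.
move=> ga; apply: eq_forallb => x; rewrite inE.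
by case: eqP => [->|_]; rewrite ?addbF // ga !implybT.
Qed.

(** An injective self-map of a finite type is a bijection. With [h] a double toggle, this matches
    the sets admitting a move with those admitting its reverse. *)
Lemma sum_pred_inj (T : finType) (h : T -> T) (P Q : pred T) :
  injective h -> (forall x, P (h x) = Q x) -> \sum_x P x = \sum_x Q x.
Proof. by move=> hI hPQ; rewrite (reindex_inj hI); apply: eq_bigr => x _; rewrite hPQ. Qed.

Lemma sum_cond (T : finType) (P Q : pred T) :
  \sum_(x | P x) Q x = \sum_x (P x && Q x).
Proof. by rewrite big_mkcond; apply: eq_bigr => x _; case: (P x). Qed.

Lemma dvd_shift t k : (t %| 2 * (k + t) + 1) = (t %| 2 * k + 1).
Proof. by rewrite mulnDr addnAC dvdn_addl // dvdn_mull. Qed.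

(** The odd numbers [2k + 1] and [2(t - 1 - k) + 1] add up to [2t]. *)
Lemma dvd_reflect t k : k < t -> (t %| 2 * (t - 1 - k) + 1) = (t %| 2 * k + 1).
Proof.
move=> kt; have e : (2 * (t - 1 - k) + 1) + (2 * k + 1) = 2 * t by lia.
have d : t %| (2 * (t - 1 - k) + 1) + (2 * k + 1) by rewrite e dvdn_mull.
apply/idP/idP => h; first by rewrite -(dvdn_addr _ h).
by rewrite -(dvdn_addl _ h).
Qed.

Lemma toggle2_inj N (a b : 'I_N) : injective (fun D => toggle a (toggle b D)).
Proof. exact: inj_comp (inv_inj (toggleK a)) (inv_inj (toggleK b)). Qed.

Lemma mem_toggle2 N (a b : 'I_N) (D : {set 'I_N}) : a != b ->
  ((a \in toggle a (toggle b D)) = (a \notin D))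
  * ((b \in toggle a (toggle b D)) = (b \notin D)).
Proof. by move=> /negPf ab; rewrite !inE !eqxx ab eq_sym ab !addbF !addbT. Qed.

Lemma weight_toggle2 N (a b : 'I_N) (D : {set 'I_N}) : a != b ->
  weight (toggle a (toggle b D)) + (a \in D) * (2 * a + 1) + (b \in D) * (2 * b + 1)
    = weight D + (a \notin D) * (2 * a + 1) + (b \notin D) * (2 * b + 1).
Proof.
move=> /negPf ab; have := weight_toggle a (toggle b D).
have -> : (a \in toggle b D) = (a \in D) by rewrite inE ab addbF.
have := weight_toggle b D; lia.
Qed.

(** Moving [k + t] to [k] toggles both elements and lowers the weight by [2t]. *)
Lemma sum_remove_shift t N n k : 0 < t -> k + t < N ->
  \sum_(D : {set 'I_N} | avoids t D && (weight D == n + 2 * t))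
     (~~ has_nat D k && has_nat D (k + t))
  = \sum_(D : {set 'I_N} | avoids t D && (weight D == n))
     (has_nat D k && ~~ has_nat D (k + t)).
Proof.
move=> t0 ktN; have kN : k < N by lia.
pose a := Ordinal kN; pose b := Ordinal ktN.
have ab : a != b by apply/eqP => /(congr1 val) /=; lia.
rewrite sum_cond [RHS]sum_cond; apply: (sum_pred_inj (@toggle2_inj _ a b)) => D.
have ea E : has_nat E k = (a \in E) := has_natE E a.
have eb E : has_nat E (k + t) = (b \in E) := has_natE E b.
rewrite !ea !eb.
have := weight_toggle2 D ab; rewrite !(mem_toggle2 _ ab) negbK /=.
(* If [t] divides [2k + 1], a set avoiding [t] contains neither [k] nor [k + t], so no set
   contributes to either sum. *)
case: (boolP (t %| 2 * k + 1)) => [bad _|good].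
  have nb : forall E : {set 'I_N}, avoids t E -> (a \in E) || (b \in E) -> False.
    by move=> E /forall_inP gE /orP[/gE|/gE] /=; rewrite ?dvd_shift bad.
  apply/idP/idP => /andP[/andP[gE _] /andP[aD bD]]; exfalso.
    by apply: (nb _ gE); rewrite !(mem_toggle2 _ ab) bD orbT.
  by apply: (nb _ gE); rewrite aD.
rewrite !avoids_toggle //=; last by rewrite dvd_shift.
case: (a \in D); case: (b \in D); rewrite ?andbF //= !andbT => w.
by congr (_ && _); lia.
Qed.

(** Deleting both elements toggles them; the two diagonal hooks have total length [2t]. *)
Lemma sum_remove_pair t N n k : t <= N -> k < t -> ~~ (t %| 2 * k + 1) ->
  \sum_(D : {set 'I_N} | avoids t D && (weight D == n + 2 * t))
     (has_nat D k && has_nat D (t - 1 - k))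
  = \sum_(D : {set 'I_N} | avoids t D && (weight D == n))
     (~~ has_nat D k && ~~ has_nat D (t - 1 - k)).
Proof.
move=> tN kt good; have kN : k < N by lia.
have k'N : t - 1 - k < N by lia.
pose a := Ordinal kN; pose b := Ordinal k'N.
(* The fixed point [k = t - 1 - k] would give [2k + 1 = t]. *)
have ab : a != b.
  apply/eqP => /(congr1 val) /= kk; case/negP: good.
  by have -> : 2 * k + 1 = t by lia.
rewrite sum_cond [RHS]sum_cond; apply: (sum_pred_inj (@toggle2_inj _ a b)) => D.
have ea E : has_nat E k = (a \in E) := has_natE E a.
have eb E : has_nat E (t - 1 - k) = (b \in E) := has_natE E b.
rewrite !ea !eb.
have := weight_toggle2 D ab; rewrite !(mem_toggle2 _ ab) /=.
rewrite !avoids_toggle //=; last by rewrite dvd_reflect.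
case: (a \in D); case: (b \in D); rewrite ?andbF //= !andbT => w.
by congr (_ && _); lia.
Qed.

(* Pairs {k, t-1-k} are counted once for each of their two elements.  The fixed
   point 2k + 1 = t is excluded from the additions, and contributes nothing to
   the removals of a set avoiding t. *)
Definition removals t N (D : {set 'I_N}) : nat :=
  \sum_(0 <= k < t) (has_nat D k && has_nat D (t - 1 - k))
  + 2 * \sum_(0 <= k < N - t) (~~ has_nat D k && has_nat D (k + t)).

Definition additions t N (D : {set 'I_N}) : nat :=
  \sum_(0 <= k < t | ~~ (t %| 2 * k + 1)) (~~ has_nat D k && ~~ has_nat D (t - 1 - k))
  + 2 * \sum_(0 <= k < N - t) (has_nat D k && ~~ has_nat D (k + t)).

(** A set avoiding [t] misses every [k] with [t] dividing [2k + 1], so the restriction drops only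
    zero terms. *)
Lemma removalsE t N (D : {set 'I_N}) : avoids t D ->
  removals t D =
  \sum_(0 <= k < t | ~~ (t %| 2 * k + 1)) (has_nat D k && has_nat D (t - 1 - k))
  + 2 * \sum_(0 <= k < N - t) (~~ has_nat D k && has_nat D (k + t)).
Proof.
move=> /avoidsP gD; congr (_ + _); rewrite [RHS]big_mkcond.
apply: eq_bigr => k _; case: ifP => // bad.
by case: (boolP (has_nat D k)) => // /gD; rewrite bad.
Qed.

(** After exchanging the sums, each index is one fixed move, whose removals at weight [n + 2t] match
    its additions at weight [n]. *)
Lemma sum_removals t N n : 0 < t -> t <= N ->
  \sum_(D : {set 'I_N} | avoids t D && (weight D == n + 2 * t)) removals t D
  = \sum_(D : {set 'I_N} | avoids t D && (weight D == n)) additions t D.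
Proof.
move=> t0 tN.
under eq_bigr => D /andP[gD _] do rewrite (removalsE gD).
rewrite /additions big_split [RHS]big_split -!big_distrr /=; congr (_ + 2 * _).
  rewrite exchange_big [RHS]exchange_big /=.
  rewrite big_nat_cond [RHS]big_nat_cond; apply: eq_bigr => k /andP[/andP[_ kt] gk].
  exact: sum_remove_pair.
rewrite exchange_big [RHS]exchange_big /=.
apply: eq_big_nat => k /andP[_ kt]; apply: sum_remove_shift => //; lia.
Qed.

Lemma has_nat_weight N (D : {set 'I_N}) k : has_nat D k -> 2 * k + 1 <= weight D.
Proof. by case/imageP => x xD ->; rewrite /weight (bigD1 x) //= leq_addr. Qed.

(** For truth values, [(1-x)(1-y) + x + y = 1 + xy] and [x(1-y) + y = (1-x)y + x]. After summation
    the linear terms cancel and the constant 1 gives the count of admissible [k]. *)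
Lemma additionsE t N (D : {set 'I_N}) : t <= N -> avoids t D ->
  weight D + 2 * t <= N ->
  additions t D = removals t D + \sum_(0 <= k < t) ~~ (t %| 2 * k + 1).
Proof.
move=> tN gD wD; rewrite removalsE // /additions.
set A1 := \sum_(0 <= k < t | _) _; set A2 := \sum_(0 <= k < N - t) _.
set R1 := \sum_(0 <= k < t | _) _; set R2 := \sum_(0 <= k < N - t) _.
set c := \sum_(0 <= k < t) _.
pose s := \sum_(0 <= k < t) has_nat D k.
have e1 : A1 + s + s = c + R1.
  have {2}-> : s = \sum_(0 <= k < t) has_nat D (t - 1 - k).
    rewrite /s big_nat_rev; apply: eq_big_nat => k /andP[_ kt].
    by congr (nat_of_bool (has_nat _ _)); lia.
  rewrite /A1 /s /c /R1 [X in X + _ + _]big_mkcond [X in _ = _ + X]big_mkcond.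
  rewrite -!big_split [RHS]big_nat /=.
  rewrite big_nat; apply: eq_bigr => k /andP[_ kt].
  have := avoidsP _ _ gD k; have := avoidsP _ _ gD (t - 1 - k).
  rewrite (dvd_reflect kt); case: (t %| _) => /=.
    by case: has_nat => [/(_ isT)//|_]; case: has_nat => [/(_ isT)//|_].
  by do 2 case: has_nat.
pose u := \sum_(0 <= k < N - t) has_nat D (k + t).
have e2 : A2 + u = R2 + \sum_(0 <= k < N - t) has_nat D k.
  by rewrite -!big_split; apply: eq_bigr => k _; do 2 case: has_nat.
have e3 : s + u = \sum_(0 <= k < N) has_nat D k.
  rewrite (@big_cat_nat _ _ _ t) //=; congr (_ + _).
  by rewrite -{1}[t]add0n big_addn.
(* An element [k] of [D] satisfies [2k + 1 <= weight D <= N - 2t], so the last [t] positions are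
   empty. *)
have e4 : \sum_(0 <= k < N) has_nat D k = \sum_(0 <= k < N - t) has_nat D k.
  rewrite (@big_cat_nat _ _ _ (N - t)) ?leq_subr //= [X in _ + X]big_nat [X in _ + X]big1 ?addn0 //.
  move=> k /andP[kl _]; case h: has_nat => //.
  have := has_nat_weight h; lia.
lia.
Qed.

Lemma sum_removals_step t N n : 0 < t -> n + 2 * t <= N ->
  \sum_(D : {set 'I_N} | avoids t D && (weight D == n + 2 * t)) removals t D
  = \sum_(D : {set 'I_N} | avoids t D && (weight D == n)) removals t D
    + (\sum_(0 <= k < t) ~~ (t %| 2 * k + 1))
      * #|[set D : {set 'I_N} | avoids t D && (weight D == n)]|.
Proof.
move=> t0 nN; rewrite sum_removals //; last by lia.
rewrite (eq_bigr (fun D : {set 'I_N} => removals t D + \sum_(0 <= k < t) ~~ (t %| 2 * k + 1))).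
  rewrite big_split sum_nat_const mulnC; congr (_ + _ * _).
  by apply: eq_card => D; rewrite inE.
move=> D /andP[gD /eqP wD]; apply: additionsE; rewrite ?wD //; lia.
Qed.

(** A removable configuration already weighs at least [2t]: either one hook [2(k + t) + 1], or two
    distinct hooks of sum [2t]. *)
Lemma removals_small t N (D : {set 'I_N}) : t <= N -> avoids t D ->
  weight D < 2 * t -> removals t D = 0.
Proof.
move=> tN gD wD; rewrite /removals.
rewrite [X in X + _]big_nat [X in _ + 2 * X]big_nat !big1 // => k /andP[_ kt].
  by rewrite andbC; case h: has_nat => //; have := has_nat_weight h; lia.
case: (boolP (has_nat D k)) => // hk; case: (boolP (has_nat D (t - 1 - k))) => // hk'.
have gk := avoidsP _ _ gD k hk.
move: (hk) (hk') => /imageP[x xD ex] /imageP[y yD ey].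
have yx : y != x.
  apply: contra gk => /eqP yx; have -> // : 2 * k + 1 = t.
  move: ex ey; rewrite yx /=; lia.
move: wD; rewrite /weight (bigD1 x) //= (bigD1 y) /=; last by rewrite yD.
by move: ex ey => /= <- <-; lia.
Qed.

(** Since [2k + 1 < 2t], the only possible multiple of [t] is [t] itself, attained exactly for [t]
    odd at [k = t./2]. *)
Lemma sum_odd_ndvd t : 0 < t -> \sum_(0 <= k < t) ~~ (t %| 2 * k + 1) = t - odd t.
Proof.
move=> t0.
suff: \sum_(0 <= k < t) ~~ (t %| 2 * k + 1) + \sum_(0 <= k < t) (t %| 2 * k + 1) = t
   /\ \sum_(0 <= k < t) (t %| 2 * k + 1) = odd t by lia.
split.
  rewrite -big_split /= (eq_bigr (fun=> 1)); last by move=> k _; case: (_ %| _).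
  by rewrite sum_nat_const_nat muln1 subn0.
have dvdE k : k < t -> (t %| 2 * k + 1) = (2 * k + 1 == t).
  move=> kt; apply/idP/eqP => [/dvdnP[q e]|-> //].
  suff q1 : q = 1 by rewrite q1 mul1n in e.
  nia.
under eq_big_nat => k /andP[_ kt] do rewrite (dvdE _ kt).
case: (boolP (odd t)) => to; last by rewrite big1 // => k _; lia.
rewrite (@big_cat_nat _ _ _ t./2) //=; last by lia.
rewrite (big_ltn (m := t./2)); last by lia.
rewrite big_nat big1 => [|k /andP[_ kt]]; last by lia.
rewrite [X in _ + (_ + X)]big_nat [X in _ + (_ + X)]big1 => [|k /andP[kt _]]; last by lia.
by have -> : 2 * t./2 + 1 == t by lia.
Qed.

(** * Self-conjugate partitions as symmetric diagrams *)

(* Self-conjugacy of the diagram with row lengths lam; it already forces lam to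
   be nonincreasing. *)
Definition symmetric_rows (lam : nat -> nat) : Prop :=
  forall i j, (j < lam i) = (i < lam j).

Lemma eq_from_ltn a b : (forall i, (i < a) = (i < b)) -> a = b.
Proof. by move=> h; have := h a; have := h b; lia. Qed.

(** If row [j] were longer, it would contain the box [(j, lam i)]. Its mirror image puts column [j],
    hence column [i], in row [lam i]; reflecting again gives [lam i < lam i]. *)
Lemma symmetric_rows_le lam i j : symmetric_rows lam -> i <= j -> lam j <= lam i.
Proof.
move=> sy ij; rewrite leqNgt; apply/negP => h.
have := sy j (lam i); rewrite h => /esym h1.
have := sy i (lam i); rewrite ltnn => /esym h2; lia.
Qed.

Lemma ltn_count_nth la i j : sorted geq la ->
  (i < count (leq j.+1) la) = (j < nth 0 la i).
Proof.
elim: la i => [|x la IH] i; first by rewrite nth_nil !ltn0.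
move=> /= s; have {}IH k := IH k (path_sorted s).
case: (leqP j.+1 x) => jx; first by case: i => [|i] //=; rewrite -IH; lia.
have c0 : count (leq j.+1) la = 0.
  apply/eqP; rewrite -leqn0 leqNgt -has_count; apply/hasPn => y yla.
  have gt : transitive geq by move=> a b c /= h1 h2; exact: leq_trans h2 h1.
  have := allP (order_path_min gt s) y yla; rewrite /=; lia.
case: i => [|i] /=; first by lia.
by rewrite -IH c0; lia.
Qed.

Lemma nth_conj_part la i j : sorted geq la ->
  (i < nth 0 (conj_part la) j) = (j < nth 0 la i).
Proof.
move=> s; rewrite -(ltn_count_nth _ _ s).
case: (ltnP j (head 0 la)) => jh.
  by rewrite (nth_map 0) ?size_iota // nth_iota // add1n.
rewrite nth_default; last by rewrite size_map size_iota.
have -> // : count (leq j.+1) la = 0.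
apply/eqP; rewrite -leqn0 leqNgt (ltn_count_nth _ _ s) nth0; lia.
Qed.

Lemma self_conj_symmetric la : is_part la -> self_conj la ->
  symmetric_rows (nth 0 la).
Proof.
by move=> /andP[s _] /eqP c i j; rewrite -(nth_conj_part _ _ s) c.
Qed.

Lemma nth_part_gt0 la i : is_part la -> (0 < nth 0 la i) = (i < size la).
Proof.
move=> /andP[_ n0]; case: (ltnP i (size la)) => h; last by rewrite nth_default.
rewrite lt0n; apply: contra n0 => /eqP <-; exact: mem_nth.
Qed.

Lemma symmetric_size la : is_part la -> symmetric_rows (nth 0 la) ->
  size la = nth 0 la 0.
Proof. by move=> p sy; apply: eq_from_ltn => i; rewrite -nth_part_gt0 // sy. Qed.

(** By symmetry the length [lam 0] of the first row is also the number of nonzero rows. *)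
Lemma part_of_symmetric lam : symmetric_rows lam ->
  let la := mkseq lam (lam 0) in
  [/\ is_part la, self_conj la & forall i, nth 0 la i = lam i].
Proof.
move=> sy la; have nthE i : nth 0 la i = lam i.
  case: (ltnP i (lam 0)) => h; first exact: nth_mkseq.
  rewrite nth_default ?size_mkseq //; have := sy 0 i; lia.
have s : sorted geq la.
  rewrite /la /mkseq sorted_map; apply: sub_sorted (iota_sorted 0 _) => i j /=.
  exact: symmetric_rows_le.
have p : is_part la.
  rewrite /is_part s; apply/negP => /(nthP 0) [i]; rewrite size_mkseq nthE.
  by have := sy 0 i; lia.
split=> //; apply/eqP.
have szE : size (conj_part la) = size la.
  by rewrite size_map size_iota -nth0 nthE size_mkseq.
apply: (@eq_from_nth _ 0) => // i _; apply: eq_from_ltn => j.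
by rewrite nth_conj_part // !nthE sy.
Qed.

(** Summing indicators over a full square makes the two ranges independent, so the sums can be
    exchanged. *)
Lemma count_boxes (P : pred (nat * nat)) N la :
  size la <= N -> (forall i, nth 0 la i <= N) ->
  count P (boxes la)
    = \sum_(0 <= i < N) \sum_(0 <= j < N) ((j < nth 0 la i) && P (i, j)).
Proof.
move=> sN lN; rewrite -sum1_count big_mkcond /boxes big_allpairs_dep.
rewrite -{1}[size la]subn0 -/(index_iota _ _) (big_nat_widen _ _ _ _ _ sN).
rewrite big_mkcond; apply: eq_bigr => i _ /=; case: ifP => h.
  rewrite -{1}[nth 0 la i]subn0 -/(index_iota _ _) (big_nat_widen _ _ _ _ _ (lN i)).
  by rewrite big_mkcond; apply: eq_bigr => j _ /=; case: (_ < _); case: (P _).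
by rewrite big1 // => j _; rewrite nth_default // leqNgt h.
Qed.

Lemma sum_interval N a b : \sum_(0 <= x < N) ((x < b) && (a < x)) = minn b N - a.+1.
Proof.
elim: N => [|N IH]; first by rewrite big_geq ?minn0.
rewrite big_nat_recr //= IH; lia.
Qed.

Lemma sum_pick N i (F : pred nat) :
  \sum_(0 <= x < N) ((x == i) && F x) = (i < N) && F i.
Proof.
elim: N => [|N IH]; first by rewrite big_geq.
rewrite big_nat_recr //= IH; case: (eqVneq N i) => [->|]; case: (F i); lia.
Qed.

(** The arm is [lambda_i - j - 1]; since column [j] has the length of row [j], the leg is
    [lambda_j - i - 1]. *)
Lemma hookE la i j : is_part la -> self_conj la -> j < nth 0 la i ->
  hook la (i, j) = nth 0 la i + nth 0 la j - (i + j) - 1.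
Proof.
move=> p c ji; have sy := self_conj_symmetric p c.
have ij : i < nth 0 la j by rewrite -sy.
have sz := symmetric_size p sy.
have le0 k : nth 0 la k <= size la by rewrite sz; exact: symmetric_rows_le.
rewrite /hook !(count_boxes _ (leqnn _) le0) /=.
rewrite [X in 1 + X](_ : _ = nth 0 la i - j.+1); last first.
  rewrite exchange_big /=.
  under eq_bigr => j' _.
    under eq_bigr => i' _ do rewrite andbCA.
    rewrite (sum_pick _ _ (fun i' => (j' < nth 0 la i') && (j < j'))).
    over.
  have -> : i < size la by have := le0 j; lia.
  by rewrite /= sum_interval (minn_idPl (le0 i)).
rewrite [X in _ + X](_ : _ = nth 0 la j - i.+1); first by lia.
under eq_bigr => i' _.
  under eq_bigr => j' _ do rewrite andbCA.
  rewrite (sum_pick _ _ (fun j' => (j' < nth 0 la i') && (i < i'))) sy.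
  over.
have -> : j < size la by have := le0 i; lia.
by rewrite /= sum_interval (minn_idPl (le0 j)).
Qed.

(** No box condition remains: outside the diagram symmetry gives [lambda_i <= j] and
    [lambda_j <= i], so the equation fails. *)
Lemma nhooksE t N la : 0 < t -> is_part la -> self_conj la -> size la <= N ->
  nhooks t la =
  \sum_(0 <= i < N) \sum_(0 <= j < N) (nth 0 la i + nth 0 la j == i + j + t + 1).
Proof.
move=> t0 p c sN; have sy := self_conj_symmetric p c.
rewrite /nhooks (@count_boxes _ N) //; last first.
  by move=> i; apply: leq_trans sN; rewrite (symmetric_size p sy) symmetric_rows_le.
apply: eq_bigr => i _; apply: eq_bigr => j _; congr nat_of_bool.
have := sy i j; case: (ltnP j (nth 0 la i)) => h /esym h'; last by lia.
by rewrite hookE //; lia.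
Qed.

(** * Diagonal hooks and beads *)

(* Only for i < N: the row end lambda_i - i - 1, shifted by N to be nonnegative. *)
Definition bead N (lam : nat -> nat) (i : nat) : nat := lam i + (N - 1 - i).

Definition beads N (lam : nat -> nat) : seq nat := mkseq (bead N lam) N.

(** A bead at [N + k] is a row with [lambda_i - i - 1 = k], that is, with diagonal hook length
    [2k + 1]. *)
Definition diag N (lam : nat -> nat) : {set 'I_N} := [set k : 'I_N | N + k \in beads N lam].

Lemma beadsP N lam m :
  reflect (exists2 i, i < N & m = bead N lam i) (m \in beads N lam).
Proof.
by apply: (iffP mapP) => -[i iN ->]; exists i => //; move: iN; rewrite mem_iota.
Qed.

Lemma beads_sorted N lam : symmetric_rows lam -> sorted gtn (beads N lam).
Proof.
move=> sy; rewrite /beads /mkseq sorted_map.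
apply: (@sub_in_sorted _ [pred i | i < N] ltn) (iota_ltn_sorted 0 N).
  move=> i j; rewrite !inE /= /bead => iN jN ij.
  have := symmetric_rows_le sy (ltnW ij); lia.
by apply/allP => i; rewrite mem_iota.
Qed.

Lemma beads_uniq N lam : symmetric_rows lam -> uniq (beads N lam).
Proof.
move=> sy; apply: sorted_uniq (beads_sorted N sy) => [a b c|a] /=; last by rewrite ltnn.
lia.
Qed.

Lemma beads_lt N lam m : symmetric_rows lam -> lam 0 <= N ->
  m \in beads N lam -> m < 2 * N.
Proof.
move=> sy lN /beadsP[i iN ->]; rewrite /bead.
have := symmetric_rows_le sy (leq0n i); lia.
Qed.

Lemma beads_compl N lam m : symmetric_rows lam -> lam 0 <= N -> m < 2 * N ->
  (m \in beads N lam) = (2 * N - 1 - m \notin beads N lam).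
Proof.
move=> sy lN mN.
(* B and its mirror image C are disjoint and have N elements each, so they fill
   [0, 2N). *)
pose B := beads N lam; pose C := [seq 2 * N - 1 - x | x <- B].
have memC x : x < 2 * N -> (x \in C) = (2 * N - 1 - x \in B).
  move=> xN; apply/mapP/idP => [[y yB ->]|xB]; last by exists (2 * N - 1 - x) => //; lia.
  have -> // : 2 * N - 1 - (2 * N - 1 - y) = y.
  by have := beads_lt sy lN yB; lia.
(* A common element would give [lam i + lam j = i + j + 1], but by symmetry this sum is at least
   [i + j + 2] or at most [i + j]. *)
have disj x : x \in B -> x \notin C.
  move=> xB; rewrite memC; last exact: beads_lt xB.
  apply/negP => /beadsP[j jN]; have /beadsP[i iN ->] := xB; rewrite /bead.
  have := symmetric_rows_le sy (leq0n i); have := symmetric_rows_le sy (leq0n j).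
  have := sy i j; lia.
have uBC : uniq (B ++ C).
  rewrite cat_uniq beads_uniq //=; apply/andP; split.
    by apply/hasPn => x xC; apply/negP => /disj; rewrite xC.
  rewrite map_inj_in_uniq ?beads_uniq // => x y /(beads_lt sy lN) xN /(beads_lt sy lN).
  lia.
have [||_ /(_ m)] := uniq_min_size uBC (s2 := iota 0 (2 * N)).
- move=> x; rewrite mem_cat mem_iota => /orP[/(beads_lt sy lN)|/mapP[y /(beads_lt sy lN)]].
    by lia.
  by lia.
- by rewrite size_cat !size_map !size_iota; lia.
rewrite mem_cat mem_iota mN -(memC _ mN) -/B.
have := disj m; case: (m \in B) => [/(_ isT) ->|_] //=.
by move=> ->.
Qed.

Lemma has_nat_diag N lam k : symmetric_rows lam -> lam 0 <= N ->
  has_nat (diag N lam) k = (N + k \in beads N lam).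
Proof.
move=> sy lN; case: (ltnP k N) => kN.
  by rewrite (has_natE (diag N lam) (Ordinal kN)) inE.
apply/idP/idP => [/has_nat_ltn|/(beads_lt sy lN)]; lia.
Qed.

Lemma lower_beads N lam k : symmetric_rows lam -> lam 0 <= N -> k < N ->
  (N - 1 - k \in beads N lam) = ~~ has_nat (diag N lam) k.
Proof.
move=> sy lN kN; rewrite has_nat_diag // [LHS]beads_compl //; last by lia.
by have -> : 2 * N - 1 - (N - 1 - k) = N + k by lia.
Qed.

(** For each [k < N], exactly one of the mirror positions [N + k] and [N - 1 - k] carries a bead,
    the upper one when [k] is in the diagonal set. *)
Lemma sum_bead N lam (F : nat -> nat) : symmetric_rows lam -> lam 0 <= N ->
  \sum_(0 <= i < N) F (bead N lam i)
  = \sum_(0 <= k < N) has_nat (diag N lam) k * F (N + k)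
    + \sum_(0 <= k < N) ~~ has_nat (diag N lam) k * F (N - 1 - k).
Proof.
move=> sy lN.
have -> : \sum_(0 <= i < N) F (bead N lam i) = \sum_(m <- beads N lam) F m.
  by rewrite big_map /index_iota subn0.
have pB : perm_eq (beads N lam) [seq m <- iota 0 (2 * N) | m \in beads N lam].
  apply: uniq_perm; rewrite ?filter_uniq ?iota_uniq ?beads_uniq // => m.
  rewrite mem_filter mem_iota add0n /=.
  by case h: (_ \in _) => //=; rewrite (beads_lt sy lN h).
rewrite (perm_big _ pB) big_filter -{1}[2 * N]subn0 -/(index_iota _ _) big_mkcond.
rewrite (@big_cat_nat _ _ _ N) //=; last by lia.
rewrite addnC; congr (_ + _).
  rewrite -{1}[N]add0n big_addn; have -> : 2 * N - N = N by lia.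
  apply: eq_bigr => k _; rewrite has_nat_diag // addnC.
  by case: (_ \in _); rewrite ?mul1n.
rewrite big_nat_rev; apply: eq_big_nat => k /andP[_ kN].
have -> : 0 + N - k.+1 = N - 1 - k by lia.
by rewrite lower_beads //; case: has_nat; rewrite ?mul1n.
Qed.

(** Summing all bead positions in two ways: choosing [N + k] instead of [N - 1 - k] gains [2k + 1],
    and the empty partition accounts for [T]. *)
Lemma weight_diag N la : is_part la -> self_conj la -> size la <= N ->
  weight (diag N (nth 0 la)) = sumn la.
Proof.
move=> p c sN; have sy := self_conj_symmetric p c.
have lN : nth 0 la 0 <= N by rewrite -symmetric_size.
have := sum_bead id sy lN; rewrite /bead big_split /=.
have -> : \sum_(0 <= i < N) nth 0 la i = sumn la.
  rewrite sumnE [RHS](big_nth 0) (@big_cat_nat _ _ _ (size la) 0 N) //=.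
  rewrite [X in _ + X]big_nat [X in _ + X]big1 ?addn0 // => i /andP[h _].
  by rewrite nth_default //; lia.
rewrite weightE -(big_mkord xpredT (fun x => has_nat (diag N (nth 0 la)) x * (2 * x + 1))).
set D := diag _ _; set T := \sum_(0 <= i < N) (N - 1 - i).
rewrite -big_split /=.
rewrite (_ : \sum_(0 <= i < N) _ = T + \sum_(0 <= k < N) has_nat D k * (2 * k + 1)); first by lia.
rewrite /T -big_split; apply: eq_big_nat => k /andP[_ kN].
by case: has_nat => /=; lia.
Qed.

Lemma nhooks_diag t N la : 0 < t -> t <= N -> is_part la -> self_conj la ->
  size la <= N -> nhooks t la = removals t (diag N (nth 0 la)).
Proof.
move=> t0 tN p c sN; have sy := self_conj_symmetric p c.
have lN : nth 0 la 0 <= N by rewrite -symmetric_size.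
rewrite (@nhooksE t N) //; set lam := nth 0 la in sy lN *; set D := diag N lam.
(* A hook of length [t] at [(i, j)] means that the beads of [i] and [j] sum to [t + 2N - 1]. Beads
   are distinct, so each [i] has at most one such [j]. *)
pose F m : nat := t + 2 * N - 1 - m \in beads N lam.
transitivity (\sum_(0 <= i < N) F (bead N lam i)).
  apply: eq_big_nat => i /andP[_ iN].
  rewrite /F -(count_uniq_mem _ (beads_uniq N sy)) -sum1_count big_map [RHS]big_mkcond.
  rewrite /index_iota subn0 big_seq [RHS]big_seq; apply: eq_bigr => j.
  rewrite mem_iota /bead => /andP[_ jN].
  have := symmetric_rows_le sy (leq0n i); have := symmetric_rows_le sy (leq0n j).
  by move=> hi hj; apply: (congr1 nat_of_bool); rewrite /=; lia.
rewrite sum_bead // -/D /F.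
(* A lower bead [N - 1 - k] has the upper partner [N + (k + t)]. *)
have e2 : \sum_(0 <= k < N) ~~ has_nat D k * (t + 2 * N - 1 - (N - 1 - k) \in beads N lam)
   = \sum_(0 <= k < N - t) (~~ has_nat D k && has_nat D (k + t)).
  rewrite (@big_cat_nat _ _ _ (N - t)) ?leq_subr //=.
  rewrite [X in _ + X]big_nat [X in _ + X]big1 ?addn0 => [|k /andP[kl kN]].
    apply: eq_big_nat => k /andP[_ kN].
    have -> : t + 2 * N - 1 - (N - 1 - k) = N + (k + t) by lia.
    by rewrite -has_nat_diag // mulnb.
  have -> : t + 2 * N - 1 - (N - 1 - k) = N + (k + t) by lia.
  rewrite -has_nat_diag // -/D; case h: (has_nat D (k + t)); last by rewrite muln0.
  by have := has_nat_ltn h; lia.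
(* An upper bead [N + k] has an upper partner for [k < t] and a lower one otherwise; the latter
   pairs repeat those of [e2], whence the factor 2. *)
have e1 : \sum_(0 <= k < N) has_nat D k * (t + 2 * N - 1 - (N + k) \in beads N lam)
   = \sum_(0 <= k < t) (has_nat D k && has_nat D (t - 1 - k))
     + \sum_(0 <= k < N - t) (~~ has_nat D k && has_nat D (k + t)).
  rewrite (@big_cat_nat _ _ _ t) //=; congr (_ + _).
    apply: eq_big_nat => k /andP[_ kt].
    have -> : t + 2 * N - 1 - (N + k) = N + (t - 1 - k) by lia.
    by rewrite -has_nat_diag // mulnb.
  rewrite -{1}[t]add0n big_addn; apply: eq_big_nat => k /andP[_ kN].
  have -> : t + 2 * N - 1 - (N + (k + t)) = N - 1 - k by lia.
  by rewrite lower_beads ?mulnb 1?andbC //; lia.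
rewrite e1 e2 /removals; lia.
Qed.

(** The diagonal set fixes the upper beads and, by complementation, the lower ones; sorting recovers
    the rows. *)
Lemma diag_inj N la mu :
  is_part la -> self_conj la -> size la <= N ->
  is_part mu -> self_conj mu -> size mu <= N ->
  diag N (nth 0 la) = diag N (nth 0 mu) -> la = mu.
Proof.
move=> pl cl sl pm cm sm e.
have syl := self_conj_symmetric pl cl; have sym := self_conj_symmetric pm cm.
have lN : nth 0 la 0 <= N by rewrite -symmetric_size.
have mN : nth 0 mu 0 <= N by rewrite -symmetric_size.
have eB : beads N (nth 0 la) = beads N (nth 0 mu).
  apply: (irr_sorted_eq (leT := gtn)) (beads_sorted N syl) (beads_sorted N sym) _.
  - by move=> a b c /=; lia.
  - by move=> a /=; rewrite ltnn.
  move=> x; case: (ltnP x (2 * N)) => xN; last first.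
    by apply/idP/idP => /beads_lt h; have := h ltac:(assumption) ltac:(assumption); lia.
  case: (leqP N x) => Nx.
    by rewrite -(subnKC Nx) -!has_nat_diag // e.
  have -> : x = N - 1 - (N - 1 - x) by lia.
  by rewrite !lower_beads ?e //; lia.
have en i : nth 0 la i = nth 0 mu i.
  case: (ltnP i N) => iN; last by rewrite !nth_default //; lia.
  have : nth 0 (beads N (nth 0 la)) i = nth 0 (beads N (nth 0 mu)) i by rewrite eB.
  by rewrite !nth_mkseq // /bead; lia.
apply: (@eq_from_nth _ 0) => [|i _]; last exact: en.
by rewrite !symmetric_size.
Qed.

Lemma durfee_ltn la i : is_part la -> symmetric_rows (nth 0 la) ->
  (i < durfee la) = (i < nth 0 la i).
Proof.
move=> p sy; apply/idP/idP; last first.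
  move=> h; rewrite /durfee; apply: (@leq_bigmax_seq _ _ _ id i.+1) => //.
  by rewrite mem_index_iota /= ltnS -(nth_part_gt0 i p); lia.
apply: contraTT; rewrite -!leqNgt => h; apply/bigmax_leqP_seq => s _ hs.
rewrite leqNgt; apply/negP => si.
have := symmetric_rows_le sy (_ : i <= s.-1); lia.
Qed.

Lemma is_BG_diag t N la : is_part la -> self_conj la -> size la <= N ->
  is_BG t la = avoids t (diag N (nth 0 la)).
Proof.
move=> p c sN; have sy := self_conj_symmetric p c.
have lN : nth 0 la 0 <= N by rewrite -symmetric_size.
rewrite /is_BG c /=.
have hk i : i < nth 0 la i -> hook la (i, i) = 2 * (nth 0 la i - i - 1) + 1.
  by move=> h; rewrite hookE //; lia.
apply/forallP/avoidsP => h.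
  move=> k; rewrite has_nat_diag // => /beadsP[i iN e].
  have il : i < nth 0 la i by move: e; rewrite /bead; lia.
  have id : i < durfee la by rewrite durfee_ltn.
  have := h (Ordinal id); rewrite /= hk //.
  by have -> : nth 0 la i - i - 1 = k by move: e; rewrite /bead; lia.
move=> [i /=]; rewrite durfee_ltn // => il.
rewrite hk //; apply: h; rewrite has_nat_diag //; apply/beadsP; exists i.
  by have := symmetric_rows_le sy (leq0n i); lia.
rewrite /bead; have := symmetric_rows_le sy (leq0n i); lia.
Qed.

(* Frobenius coordinates: the first d rows are prescribed by D, the others are
   the columns below the Durfee square. *)
Lemma diag_surj N (D : {set 'I_N}) :
  exists la, [/\ is_part la, self_conj la, size la <= N & diag N (nth 0 la) = D].
Proof.
pose ds := [seq k <- rev (iota 0 N) | has_nat D k]; pose d := size ds.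
have tr : transitive gtn by move=> a b c /=; lia.
have sds : sorted gtn ds.
  by apply: sorted_filter => //; rewrite rev_sorted iota_ltn_sorted.
have memds k : (k \in ds) = has_nat D k.
  rewrite mem_filter mem_rev mem_iota add0n; case h: has_nat => //=.
  exact: has_nat_ltn h.
have dsN i : i < d -> nth 0 ds i < N.
  by move=> h; apply: (@has_nat_ltn _ D); rewrite -memds mem_nth.
(* Strictly decreasing integers drop by at least 1 per step; this makes the rows of [mu]
   nonincreasing and at least [d] long. *)
have dec i j : i <= j -> j < d -> nth 0 ds j + (j - i) <= nth 0 ds i.
  elim: j => [|j IH] ij jd; first by have -> : i = 0 by [lia|]; lia.
  case: (eqVneq i j.+1) => [->|ne]; first by lia.
  have := IH ltac:(lia) ltac:(lia).
  have := sorted_ltn_nth tr 0 sds j j.+1; rewrite !inE -/d /=.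
  by move=> /(_ (ltnW jd) jd (ltnSn j)); lia.
pose mu := mkseq (fun i => nth 0 ds i + i + 1) d.
have muE i : i < d -> nth 0 mu i = nth 0 ds i + i + 1 by exact: nth_mkseq.
have mu0 i : d <= i -> nth 0 mu i = 0 by move=> h; rewrite nth_default ?size_mkseq.
have mud i : i < d -> d <= nth 0 mu i.
  move=> h; rewrite muE //; have := @dec i d.-1; lia.
have smu : sorted geq mu.
  rewrite /mu /mkseq sorted_map.
  apply: (@sub_in_sorted _ [pred i | i < d] ltn) (iota_ltn_sorted 0 d).
    by move=> i j; rewrite !inE /= => _ jd ij; have := dec i j; lia.
  by apply/allP => i; rewrite mem_iota.
pose lam i := if i < d then nth 0 mu i else count (leq i.+1) mu.
have sy : symmetric_rows lam.
  move=> i j; rewrite /lam; case: (ltnP i d) => id; case: (ltnP j d) => jd.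
  - by have := mud i id; have := mud j jd; lia.
  - by rewrite ltn_count_nth.
  - by rewrite ltn_count_nth.
  - by rewrite !ltn_count_nth // !mu0.
have lN : lam 0 <= N.
  rewrite /lam; case: ltnP => h; last by rewrite /mu (_ : d = 0) //; lia.
  by rewrite muE //; have := dsN 0 h; lia.
have [p c e] := part_of_symmetric sy; exists (mkseq lam (lam 0)); split=> //.
  by rewrite size_mkseq.
have -> : diag N (nth 0 (mkseq lam (lam 0))) = diag N lam.
  by apply/setP => x; rewrite !inE /beads (eq_mkseq (g := bead N lam)) // /bead => i; rewrite e.
apply/setP => x; rewrite -!has_natE has_nat_diag // -memds.
apply/beadsP/(nthP 0) => -[i id].
  rewrite /bead => ex; have il : i < lam i by lia.
  case: (ltnP i d) => h; last first.
    by move: il; rewrite /lam (ltnNge i d) h /= ltn_count_nth // mu0.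
  by exists i => //; move: ex; rewrite /lam h /= muE //; lia.
rewrite -/d in id; have dN : d <= N.
  by rewrite /d size_filter (leq_trans (count_size _ _)) // size_rev size_iota.
move=> <-; exists i; first by lia.
by rewrite /bead /lam id /= muE //; lia.
Qed.

(** * The recursion *)

Lemma intpart_bounds n (la : intpart n) N : n <= N ->
  [/\ is_part la, sumn la = n & size la <= N].
Proof.
case: la => la /= /andP[p /eqP s] nN; split=> //.
by apply: leq_trans nN; rewrite -s size_le_sumn //; case/andP: p.
Qed.

Lemma BG_self_conj t n (la : intpart n) : la \in BG t n -> self_conj la.
Proof. by rewrite inE => /andP[]. Qed.

Lemma diag_BG_inj N t n : n <= N ->
  {in BG t n &, injective (fun la : intpart n => diag N (nth 0 la))}.
Proof.
move=> nN la mu /BG_self_conj cl /BG_self_conj cm e; apply: val_inj => /=.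
have [pl _ sl] := intpart_bounds la nN; have [pm _ sm] := intpart_bounds mu nN.
exact: diag_inj e.
Qed.

Lemma diag_BG N t n : n <= N ->
  [set diag N (nth 0 la) | la : intpart n in BG t n]
  = [set D : {set 'I_N} | avoids t D && (weight D == n)].
Proof.
move=> nN; apply/setP => D; rewrite inE; apply/imsetP/andP => [[la laB ->]|[gD /eqP wD]].
  have cl := BG_self_conj laB; have [pl sl zl] := intpart_bounds la nN.
  by rewrite weight_diag // sl -is_BG_diag //; move: laB; rewrite inE.
have [la [p c z e]] := diag_surj D.
have laP : is_part_of n la by rewrite /is_part_of p -wD -e weight_diag //=.
by exists (IntPart laP); rewrite //= inE (@is_BG_diag _ N) //= e.
Qed.

Lemma sum_nhooks_BG N t n : 0 < t -> t <= N -> n <= N ->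
  \sum_(la in BG t n) nhooks t la
  = \sum_(D : {set 'I_N} | avoids t D && (weight D == n)) removals t D.
Proof.
move=> t0 tN nN.
have := @big_imset _ 0 addn _ _ _ _ (@removals t N) (@diag_BG_inj N t n nN).
rewrite diag_BG // => e.
transitivity (\sum_(la in BG t n) removals t (diag N (nth 0 la))).
  apply: eq_bigr => la /BG_self_conj c; have [p _ z] := intpart_bounds la nN.
  exact: nhooks_diag.
by rewrite -e; apply: eq_bigl => D; rewrite inE.
Qed.

Lemma card_BG N t n : n <= N ->
  #|BG t n| = #|[set D : {set 'I_N} | avoids t D && (weight D == n)]|.
Proof. by move=> nN; rewrite -diag_BG // card_in_imset //; apply: diag_BG_inj. Qed.

Lemma sum_nhooks_BG_step t n : 0 < t ->
  \sum_(la in BG t (n + 2 * t)) nhooks t la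
  = \sum_(la in BG t n) nhooks t la + (t - odd t) * #|BG t n|.
Proof.
(* Both weights are encoded with the same [N = n + 2t], as the recursion on sets requires. *)
move=> t0; rewrite !(@sum_nhooks_BG (n + 2 * t)) //; try lia.
by rewrite sum_removals_step // sum_odd_ndvd // (@card_BG (n + 2 * t)) //; lia.
Qed.

Lemma sum_nhooks_BG_small t n : 0 < t -> n < 2 * t ->
  \sum_(la in BG t n) nhooks t la = 0.
Proof.
move=> t0 nt; rewrite !(@sum_nhooks_BG (2 * t)) //; try lia.
rewrite big1 // => D /andP[gD /eqP wD]; apply: removals_small => //; lia.
Qed.

(** The term [j = 1] is [G m], and the others shift by one; shifted indices beyond [m] fail the
    guard. *)
Lemma sum_guard_step (G : nat -> nat) t m : 0 < t ->
  \sum_(1 <= j < (m + 2 * t).+1 | 2 * j * t <= m + 2 * t) G (m + 2 * t - 2 * j * t)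
  = G m + \sum_(1 <= j < m.+1 | 2 * j * t <= m) G (m - 2 * j * t).
Proof.
move=> t0; rewrite big_ltn_cond; last by lia.
rewrite muln1 leq_addl addnK big_add1 /=; congr (_ + _).
rewrite (@big_cat_nat _ _ _ m.+1 1) //=; last by lia.
rewrite [X in _ + X]big_nat_cond [X in _ + X]big1 ?addn0 => [|j /andP[/andP[mj _]]]; last by nia.
by apply: eq_big => [j|j _]; [|congr G]; nia.
Qed.

Lemma sum_nhooks_BG_eq t n : 0 < t ->
  \sum_(la in BG t n) nhooks t la
  = (t - odd t) * \sum_(1 <= j < n.+1 | 2 * j * t <= n) #|BG t (n - 2 * j * t)|.
Proof.
move=> t0; elim/ltn_ind: n => n IH; case: (ltnP n (2 * t)) => nt.
  rewrite sum_nhooks_BG_small // big_nat_cond big1 ?muln0 // => j.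
  by move=> /andP[/andP[j0 _]]; nia.
rewrite -(subnK nt) sum_nhooks_BG_step // IH; last by lia.
by rewrite (sum_guard_step (fun m => #|BG t m|)) // mulnDr addnC.
Qed.

(** An even [t] divides no odd number [2k + 1], so the condition on diagonal hooks is vacuous. *)
Lemma BG_even t n : ~~ odd t -> BG t n = SC n.
Proof.
move=> te; apply/setP => la; rewrite !inE.
case c: (self_conj la); last by rewrite /is_BG c.
have [p _ z] := intpart_bounds la (leqnn n).
rewrite (is_BG_diag _ p c z); apply/avoidsP => k _.
by apply: contra te => /dvdn_odd; rewrite addn1 /= oddM => ->.
Qed.

(* In the sums over j >= 1, the guard 2 * j * t <= n discards the terms of
   negative weight, which are zero; since t > 0, it fails for all j > n. *)
Theorem theorem1p5 :
  (forall n t : nat, 2 <= t -> ~~ odd t ->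
     \sum_(la in SC n) nhooks t la
       = t * \sum_(1 <= j < n.+1 | 2 * j * t <= n) #|SC (n - 2 * j * t)|
     /\ \sum_(la in SC n) nhooks t la = 0 %[mod t])
  /\
  (forall n t : nat, 3 <= t -> odd t ->
     \sum_(la in BG t n) nhooks t la
       = (t - 1) * \sum_(1 <= j < n.+1 | 2 * j * t <= n) #|BG t (n - 2 * j * t)|
     /\ \sum_(la in BG t n) nhooks t la = 0 %[mod t - 1]).
Proof.
split=> n t t_ge t_odd.
  have e : \sum_(la in SC n) nhooks t la
       = t * \sum_(1 <= j < n.+1 | 2 * j * t <= n) #|SC (n - 2 * j * t)|.
    rewrite -(BG_even n t_odd) sum_nhooks_BG_eq; last by lia.
    rewrite (negPf t_odd) subn0; congr (_ * _); apply: eq_bigr => j _.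
    by rewrite BG_even.
  by split=> //; rewrite e modnMr mod0n.
have e := sum_nhooks_BG_eq n (ltnW (ltnW t_ge)); rewrite t_odd in e.
by split=> //; rewrite e modnMr mod0n.
Qed.
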